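(* If $G$ is an $(X,Y)$-bigraph with maximum degree at most $3$, then $G$ has a path $X$-cover of size at most $\mathrm{def}_{\Lambda}(G)$.
   Context: An $(X,Y)$-bigraph is a bipartite graph with a specified ordered bipartition $(X,Y)$. A path $X$-cover of $G$ is a set of pairwise vertex-disjoint paths in $G$ that together cover all vertices of $X$. For $S \subseteq X$, $\Lambda(S)$ denotes the set of vertices in $Y$ having at least two neighbors in $S$. The $\Lambda$-deficiency of $S$ is $\mathrm{def}_{\Lambda}(G,S) = |S| - |\Lambda(S)|$, and $\mathrm{def}_{\Lambda}(G) = \max\{\mathrm{def}_{\Lambda}(G,S) : S \subseteq X\}$. *)

(* Defs.v *)
From mathcomp Require Import all_boot all_order all_algebra.
Set Implicit Arguments.
Unset Strict Implicit.
Unset Printing Implicit Defensive.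
Import Order.TTheory GRing.Theory Num.Theory.

Section Bigraphs.
Variables (T : finType) (e : rel T).

Definition simple_graph : Prop := symmetric e /\ irreflexive e.

Definition neighbors (v : T) : {set T} := [set w | e v w].

Definition max_degree : nat := \max_(v : T) #|neighbors v|.

Definition bipartition (X Y : {set T}) : Prop :=
  [/\ X :|: Y = [set: T], [disjoint X & Y] &
      forall u v, e u v ->
        (u \in X) && (v \in Y) || (u \in Y) && (v \in X)].

Definition bigraph (X Y : {set T}) : Prop :=
  simple_graph /\ bipartition X Y.

(* A path is given by its vertices in order; one-vertex paths are allowed,
   the empty sequence is not. *)
Definition is_path (p : seq T) : bool :=
  if p is x :: s then path e x s && uniq (x :: s) else false.

(* A set of disjoint paths is given as a sequence: disjoint nonempty paths are
   distinct, so [size P] is the size of the set. *)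
Definition path_cover (X : {set T}) (P : seq (seq T)) : Prop :=
  [/\ all is_path P,
      pairwise (fun p q : seq T => [disjoint p & q]) P &
      forall x, x \in X -> exists2 p, p \in P & x \in p].

Definition Lambda (Y S : {set T}) : {set T} :=
  [set y in Y | 2 <= #|neighbors y :&: S|].

Definition def_Lambda_at (Y S : {set T}) : int :=
  (#|S|%:Z - #|Lambda Y S|%:Z)%R.

(* The base value is the deficiency of the empty subset of X, so that this is
   the maximum over the subsets of X; see [def_Lambda_ge] and
   [def_Lambda_attained]. *)
Definition def_Lambda (X Y : {set T}) : int :=
  \big[Order.max/def_Lambda_at Y set0]_(S : {set T} | S \subset X)
     def_Lambda_at Y S.

Lemma def_Lambda_ge (X Y S : {set T}) :
  S \subset X -> (def_Lambda_at Y S <= def_Lambda X Y)%R.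
Proof. by move=> sSX; apply: (le_bigmax_cond _ (def_Lambda_at Y)). Qed.

Lemma def_Lambda_attained (X Y : {set T}) :
  exists2 S : {set T}, S \subset X & def_Lambda X Y = def_Lambda_at Y S.
Proof.
rewrite /def_Lambda; elim/big_ind: _ => [|a b [A sA ->] [B sB ->]|S sS].
- by exists set0; rewrite ?sub0set.
- by case: (leP (def_Lambda_at Y A)) => _; [exists B | exists A].
- by exists S.
Qed.

End Bigraphs.

(* Main.v *)
(* By induction on |X| there are a path X-cover P and a set S with
   |P| <= |S| - |Lambda(S)|. Call a vertex of Y effective if it has at least two
   neighbors in X.
   - A vertex x of X without effective neighbors is its own path, and joins S.
   - If a has y as its only effective neighbor and y has exactly one other
     neighbor b, delete a, y, b, which form a path, and put a in S; if a and b
     both have y as their only effective neighbor, do the same and put both a and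
     b in S.
   - Otherwise every effective y has two neighbors in X that have two effective
     neighbors, so there is a cycle x, y_1, x_2, y_2, ..., x_m, y_m. Delete it
     except x, and replace y_1 and y_m by one vertex y* adjacent to all their
     remaining neighbors. As the maximum degree is 3, each vertex of the cycle has
     at most one further neighbor, so y* still has at most three. A path using y*
     is rerouted through y_1, x_2, ..., x_m, y_m in one of the two directions; if
     no path uses y*, then x is the end of its path, which is prolonged by
     y_m, x_m, ..., x_2. The set S remains valid, unless y_1 and y_m both have two
     neighbors in S, in which case x is removed from S. *)
Require Import Defs.
From mathcomp Require Import all_boot all_order all_algebra.
Set Implicit Arguments.
Unset Strict Implicit.
Unset Printing Implicit Defensive.

(** * Sorted sequences, and cycles in finite graphs *)

Section Lists.
Variable T : eqType.
Implicit Types (r : rel T) (s q : seq T).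

Lemma sorted_glue r q a b s :
  sorted r (rcons q a ++ b :: s) =
  [&& sorted r (rcons q a), r a b & sorted r (b :: s)].
Proof. by case: q => [|z q] /=; rewrite ?andbT // cat_path last_rcons /=. Qed.

Lemma sorted_rev_sym r s : symmetric r -> sorted r s -> sorted r (rev s).
Proof.
by move=> sr rs; rewrite rev_sorted; apply: sub_sorted rs => a b; rewrite sr.
Qed.

End Lists.

(** A path is grown at its front inside [V]. If both neighbors of the front already lie on the path,
    one of them is not the next vertex and closes a cycle. *)
Lemma exists_ucycle (T : finType) (r : rel T) (V : {set T}) :
    symmetric r -> irreflexive r -> V != set0 ->
    {in V, forall v, exists a b, [/\ a != b, a \in V, b \in V, r v a & r v b]} ->
  exists2 c : seq T, ucycle r c & 2 < size c.
Proof.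
move=> sr ir /set0Pn[v0 Vv0] dV.
(* The condition [0 < index a s] says that [a] is not the successor of [z], so the cycle has at
   least three vertices. *)
have close z s a : path r z s -> uniq (z :: s) -> a \in s -> r z a ->
    0 < index a s -> exists2 c : seq T, ucycle r c & 2 < size c.
  move=> pzs uzs a_s rza ia; exists (z :: take (index a s).+1 s); last first.
    by rewrite /= size_takel ?index_mem // ltnS.
  have las : last z (take (index a s).+1 s) = a.
    by rewrite (take_nth z) ?index_mem // last_rcons nth_index.
  apply/andP; split; last first.
    by move: uzs; rewrite /= => /andP[zs us]; rewrite take_uniq // andbT;
       apply: contra zs; apply: mem_take.
  by rewrite /= rcons_path las sr rza take_path.
(* A path with [size s = #|T|] has one vertex too many, so growth must end in a cycle. *)
have [|[z [s [_ _ uzs szs]]]] : (exists2 c : seq T, ucycle r c & 2 < size c) \/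
    exists z s, [/\ z \in V, path r z s, uniq (z :: s) & size s = #|T|].
  elim: #|T| => [|n [|[z [s [Vz pzs uzs szs]]]]]; [|by left|].
    by right; exists v0, [::].
  have [a [b [ab Va Vb rza rzb]]] := dV z Vz.
  have [a_s|a_s] := boolP (a \in z :: s); last first.
    right; exists a, (z :: s).
    by rewrite cons_uniq a_s uzs /= sr rza pzs szs.
  have [b_s|b_s] := boolP (b \in z :: s); last first.
    right; exists b, (z :: s).
    by rewrite cons_uniq b_s uzs /= sr rzb pzs szs.
  have nz v : r z v -> v \in z :: s -> v \in s.
    by rewrite inE => + /predU1P[vz|//]; rewrite vz ir.
  left; have [ia|ia] := posnP (index a s); last first.
    exact: (close z s a pzs uzs (nz _ rza a_s)).
  apply: (close z s b pzs uzs (nz _ rzb b_s) rzb).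
  rewrite lt0n; apply: contra ab => /eqP ib.
  by rewrite -(nth_index z (nz _ rza a_s)) ia -ib nth_index ?nz.
  by [].
by move: (card_uniqP uzs) (max_card (mem (z :: s))) => -> /=; rewrite szs ltnn.
Qed.

(* The graph is given by the neighborhoods [nb y] of the vertices [y] in [Y], where
   only the part of [nb y] in [X] counts; deleting vertices just shrinks [X] or [Y]. *)
Section TripleSystems.
Variable T : finType.
Implicit Types (X Y S : {set T}) (nb : T -> {set T}) (p q : seq T) (P : seq (seq T)).

(** * Covers by paths with both ends in [X], and the pair [P], [S] built by the induction *)

Definition subcubic X Y nb :=
  [/\ [disjoint X & Y], {in Y, forall y, #|nb y :&: X| <= 3}
    & {in X, forall x, #|[set y in Y | x \in nb y]| <= 3}].

Definition adj X Y nb : rel T := fun u v =>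
  [&& u \in X, v \in Y & u \in nb v] || [&& v \in X, u \in Y & v \in nb u].

Definition Lam Y nb S := [set y in Y | 2 <= #|nb y :&: S|].

Definition headX X p := if p is x :: _ then x \in X else false.

(** With both ends in [X], a vertex of [Y] on the path always has a predecessor and a successor; the
    empty sequence is excluded too. *)
Definition good X Y nb p :=
  [&& headX X p, headX X (rev p), sorted (adj X Y nb) p & all (mem (X :|: Y)) p].

(** [uniq (flatten P)] says at once that no path repeats a vertex and that the paths are
    disjoint. *)
Definition cover X Y nb P :=
  [/\ all (good X Y nb) P, uniq (flatten P) & {subset X <= flatten P}].

Definition solvable X Y nb :=
  exists P S, [/\ cover X Y nb P, S \subset X & size P + #|Lam Y nb S| <= #|S|].

Lemma adj_sym X Y nb : symmetric (adj X Y nb).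
Proof. by move=> u v; rewrite /adj orbC. Qed.

Lemma adj_irr X Y nb : [disjoint X & Y] -> irreflexive (adj X Y nb).
Proof.
move=> dXY u; rewrite /adj orbb; apply/negP=> /and3P[uX uY _].
by move: (disjointFr dXY uX); rewrite uY.
Qed.

Lemma adjXY X Y nb u v : [disjoint X & Y] -> u \in X ->
  adj X Y nb u v = (v \in Y) && (u \in nb v).
Proof.
by move=> dXY uX; rewrite /adj uX (disjointFr dXY uX) /= andbF orbF.
Qed.

Lemma adjYX X Y nb u v : [disjoint X & Y] -> u \in Y ->
  adj X Y nb u v = (v \in X) && (v \in nb u).
Proof.
by move=> dXY uY; rewrite /adj uY (disjointFl dXY uY) /=.
Qed.

Lemma subcubic_sub X Y X' Y' nb :
  X' \subset X -> Y' \subset Y -> subcubic X Y nb -> subcubic X' Y' nb.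
Proof.
move=> sX sY [dXY dY dX]; split.
- by apply: disjointWl sX _; apply: disjointWr sY _.
- move=> y /(subsetP sY) /dY; apply: leq_trans.
  by apply: subset_leq_card; apply: setIS.
- move=> x /(subsetP sX) /dX; apply: leq_trans.
  apply: subset_leq_card; apply/subsetP=> y; rewrite !inE => /andP[+ ->].
  by move/(subsetP sY)->.
Qed.

Lemma good_sub X Y X' Y' nb p :
  X' \subset X -> Y' \subset Y -> good X' Y' nb p -> good X Y nb p.
Proof.
move=> /subsetP sX /subsetP sY /and4P[h1 h2 h3 h4].
have hX q : headX X' q -> headX X q by case: q => //= a ? /sX.
rewrite /good !hX //=; apply/andP; split.
  apply: sub_sorted h3 => u v; rewrite /adj.
  by case/orP=> /and3P[/sX-> /sY-> ->]; rewrite ?orbT.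
by apply: sub_all h4 => a /=; rewrite !inE => /orP[/sX->|/sY->] //; rewrite orbT.
Qed.

Lemma good_rev X Y nb p : good X Y nb (rev p) = good X Y nb p.
Proof.
apply/idP/idP; rewrite /good => /and4P[h1 h2 h3 h4].
  rewrite revK in h2; rewrite h1 h2 -all_rev h4 andbT /=.
  by rewrite -(revK p) sorted_rev_sym //; apply: adj_sym.
by rewrite revK h1 h2 all_rev h4 andbT /= sorted_rev_sym //; apply: adj_sym.
Qed.

Lemma cover_perm X Y nb P Q : perm_eq P Q -> cover X Y nb P -> cover X Y nb Q.
Proof.
move=> PQ [gP uP cP]; split.
- by rewrite -(perm_all _ PQ).
- by rewrite -(perm_uniq (perm_flatten PQ)).
- by move=> x /cP; rewrite (perm_mem (perm_flatten PQ)).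
Qed.

Lemma cover_mem X Y nb P v : cover X Y nb P -> v \in flatten P -> v \in X :|: Y.
Proof.
case=> gP _ _ /flattenP[p pP vp]; have /and4P[_ _ _ /allP] := allP gP p pP.
by move/(_ v vp).
Qed.

(** The new path costs one and [A] enlarges [S] by [#|A|], so [Lam] may grow by [#|A|.-1]. *)
Lemma solvable_cons X Y X' Y' nb p (A : {set T}) :
    X' \subset X -> Y' \subset Y -> good X Y nb p -> uniq p ->
    {in p, forall v, v \notin X' :|: Y'} -> X \subset X' :|: [set v in p] ->
    A \subset X -> [disjoint A & X'] -> A != set0 ->
    (forall S, S \subset X' ->
      #|Lam Y nb (A :|: S)| <= #|Lam Y' nb S| + #|A|.-1) ->
  solvable X' Y' nb -> solvable X Y nb.
Proof.
move=> sX sY gp up dp cX sA dA A0 bL [P [S [[gP uP cP] sS bS]]].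
exists (p :: P), (A :|: S); split.
- split=> /=.
  + by rewrite gp; apply: sub_all gP => q; exact: good_sub sX sY.
  + rewrite cat_uniq up uP andbT /=; apply/hasPn=> v vP.
    apply/negP=> vp; have /negP[] := dp v vp.
    by apply: (@cover_mem X' Y' nb P) vP; split.
  + move=> x /(subsetP cX); rewrite !inE mem_cat orbC => /orP[-> //|/cP->].
    by rewrite orbT.
- by rewrite subUset sA (subset_trans sS).
- rewrite cardsU (_ : A :&: S = set0) ?cards0 ?subn0; last first.
    by apply/eqP; rewrite setI_eq0; apply: disjointWr sS dA.
  have A_gt0 : 0 < #|A| by rewrite card_gt0.
  rewrite -(prednK A_gt0) /= !addSn ltnS.
  apply: leq_trans (leq_add (leqnn _) (bL S sS)) _.
  by rewrite addnA addnC leq_add2l.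
Qed.

(** * Reductions that split off a single path *)

Definition eff X Y nb x := [set y in Y | (x \in nb y) && (1 < #|nb y :&: X|)].

(** Hence a vertex added to [S] can affect [Lam] only at its effective neighbors. *)
Lemma Lam_eff X Y nb S x y :
  S \subset X -> y \in Lam Y nb S -> x \in nb y -> y \in eff X Y nb x.
Proof.
move=> sS; rewrite !inE => /andP[-> y2] -> /=.
by apply: leq_trans y2 _; apply/subset_leq_card/setIS.
Qed.

Lemma Lam_setU Y nb (A S : {set T}) y :
  [disjoint nb y & A] -> (y \in Lam Y nb (A :|: S)) = (y \in Lam Y nb S).
Proof. by move=> dA; rewrite !inE setIUr (disjoint_setI0 dA) set0U. Qed.

Lemma good_edge X Y nb a y b :
    a \in X -> b \in X -> y \in Y -> a \in nb y -> b \in nb y ->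
  good X Y nb [:: a; y; b].
Proof.
by move=> aX bX yY ay byb; rewrite /good /= /adj aX bX yY ay byb !inE aX bX yY !orbT.
Qed.

Lemma solvable_isolated X Y nb x :
    [disjoint X & Y] -> x \in X -> eff X Y nb x = set0 ->
  solvable (X :\ x) Y nb -> solvable X Y nb.
Proof.
move=> dXY xX ex0; have xY := disjointFr dXY xX.
apply: (@solvable_cons _ _ _ _ _ [:: x] [set x]) => //.
- exact: subsetDl.
- by rewrite /good /= xX inE xX.
- by move=> v; rewrite !inE => /eqP->; rewrite eqxx xY.
- by apply/subsetP=> v vX; rewrite !inE vX andbT orNb.
- by rewrite sub1set.
- by rewrite disjoints1 !inE eqxx.
- by rewrite -card_gt0 cards1.
move=> S sS; rewrite cards1 addn0; apply/subset_leq_card/subsetP=> y yL.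
have sxS : x |: S \subset X.
  by rewrite subUset sub1set xX (subset_trans sS) ?subsetDl.
rewrite -(@Lam_setU _ _ [set x]) // disjoint_sym disjoints1.
by apply/negP=> /(Lam_eff sxS yL); rewrite ex0 inE.
Qed.

(** [Lam] does not grow: only [y] could be gained through [a], but its other neighbor [b] is never
    in [S]. *)
Lemma solvable_pendant X Y nb y a b :
    [disjoint X & Y] -> a != b -> nb y :&: X = [set a; b] ->
    eff X Y nb a = [set y] ->
  solvable (X :\: [set a; b]) (Y :\ y) nb -> solvable X Y nb.
Proof.
move=> dXY ab nby ea.
have [aX ay] : a \in X /\ a \in nb y.
  by have: a \in nb y :&: X; [rewrite nby !inE eqxx | case/setIP].
have [bX yb] : b \in X /\ b \in nb y.
  by have: b \in nb y :&: X; [rewrite nby !inE eqxx orbT | case/setIP].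
have yY : y \in Y by have: y \in eff X Y nb a; [rewrite ea inE | rewrite inE => /andP[]].
have aY := disjointFr dXY aX; have bY := disjointFr dXY bX.
have yX := disjointFl dXY yY.
have ya : (y == a) = false by apply: contraFF yX => /eqP->.
have yb' : (y == b) = false by apply: contraFF yX => /eqP->.
apply: (@solvable_cons _ _ _ _ _ [:: a; y; b] [set a]) => //.
- exact: subsetDl.
- exact: subsetDl.
- exact: good_edge.
- by rewrite /= !inE eq_sym ya ab yb'.
- by move=> v; rewrite !inE => /or3P[]/eqP->;
    rewrite ?eqxx ?aX ?bX ?yX ?aY ?bY ?andbF ?orbT.
- apply/subsetP=> v vX; rewrite !inE vX andbT.
  by case: (v == a); case: (v == b); rewrite ?orbT.
- by rewrite sub1set.
- by rewrite disjoints1 !inE eqxx.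
- by rewrite -card_gt0 cards1.
move=> S sS; rewrite cards1 addn0; apply/subset_leq_card/subsetP=> z zL.
have saS : a |: S \subset X.
  by rewrite subUset sub1set aX (subset_trans sS) ?subsetDl.
have [az|az] := boolP (a \in nb z).
  have := Lam_eff saS zL az; rewrite ea inE => /eqP zy.
  move: zL; rewrite zy inE => /andP[_]; rewrite ltnNge -(cards1 a) => /negP[].
  apply/subset_leq_card/subsetP=> v /setIP[vy]; case/setU1P=> [->|vS].
    by rewrite inE.
  have := subsetP sS _ vS; rewrite !inE => /andP[/negP[]].
  have: v \in nb y :&: X by rewrite inE vy (subsetP saS) // inE vS orbT.
  by rewrite nby !inE.
have: z \in Lam Y nb S.
  by rewrite -(@Lam_setU _ _ [set a]) // disjoint_sym disjoints1.
rewrite !inE => /andP[-> ->]; rewrite !andbT.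
by apply: contra az => /eqP->.
Qed.

(** [Lam] gains at most [y], which is paid for by having two vertices in [A]. *)
Lemma solvable_cherry X Y nb y a b :
    [disjoint X & Y] -> a != b -> a \in X -> b \in X ->
    eff X Y nb a = [set y] -> eff X Y nb b = [set y] ->
  solvable (X :\: [set a; b]) (Y :\ y) nb -> solvable X Y nb.
Proof.
move=> dXY ab aX bX ea eb.
have : y \in eff X Y nb a by rewrite ea inE.
rewrite inE => /and3P[yY ay _].
have : y \in eff X Y nb b by rewrite eb inE.
rewrite inE => /and3P[_ yb _].
have aY := disjointFr dXY aX; have bY := disjointFr dXY bX.
have yX := disjointFl dXY yY.
have ya : (y == a) = false by apply: contraFF yX => /eqP->.
have yb' : (y == b) = false by apply: contraFF yX => /eqP->.
have sA : [set a; b] \subset X by rewrite subUset !sub1set aX.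
apply: (@solvable_cons _ _ _ _ _ [:: a; y; b] [set a; b]) => //.
- exact: subsetDl.
- exact: subsetDl.
- exact: good_edge.
- by rewrite /= !inE eq_sym ya ab yb'.
- by move=> v; rewrite !inE => /or3P[]/eqP->;
    rewrite ?eqxx ?aX ?bX ?yX ?aY ?bY ?andbF ?orbT.
- apply/subsetP=> v vX; rewrite !inE vX andbT.
  by case: (v == a); case: (v == b); rewrite ?orbT.
- by rewrite disjoint_sym disjoints_subset subsetDr.
- by rewrite -card_gt0 cards2.
move=> S sS; rewrite cards2 ab addn1.
have sAS : [set a; b] :|: S \subset X.
  by rewrite subUset sA (subset_trans sS) ?subsetDl.
apply: (@leq_trans #|y |: Lam (Y :\ y) nb S|); last first.
  by rewrite cardsU1; case: (_ \notin _).
apply/subset_leq_card/subsetP=> z zL.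
have [-> |zy] := eqVneq z y; first by rewrite !inE eqxx.
have: z \in Lam Y nb S.
  rewrite -(@Lam_setU _ _ [set a; b]) //; apply/pred0P=> v /=; apply/negbTE.
  apply: contra zy => /andP[vz]; rewrite !inE => /orP[]/eqP v_eq.
  - by have := Lam_eff sAS zL vz; rewrite v_eq ea inE.
  - by have := Lam_eff sAS zL vz; rewrite v_eq eb inE.
by rewrite !inE zy => /andP[-> ->]; rewrite orbT.
Qed.

(** * Contraction of a cycle *)

Definition merge_nb nb (a b v : T) := if v == a then nb a :|: nb b else nb v.

(* [ya] plays the role of y* in the reduced graph [X'], [Y'], [nb']. *)
Section CycleStep.
Variables (X Y : {set T}) (nb : T -> {set T}) (x ya yb : T) (mid : seq T).
(** [D] is the cycle without [x], so [x] survives in [X'], and [ya] is the only vertex of [D] that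
    survives. *)
Let D := ya :: rcons mid yb.
Let X' := X :\: [set v in D].
Let Y' := ya |: (Y :\: [set v in D]).
Let nb' := merge_nb nb ya yb.
Hypotheses (sc : subcubic X Y nb) (xX : x \in X).
Hypothesis uc : ucycle (adj X Y nb) (x :: D).

Let dXY : [disjoint X & Y]. Proof. by case: sc. Qed.

Let uD : uniq D. Proof. by case/andP: uc => _ /andP[]. Qed.

Let xD : x \notin D. Proof. by case/andP: uc => _ /andP[]. Qed.

Let ya_yb : (yb == ya) = false.
Proof.
have := uD; rewrite /D /= mem_rcons inE negb_or eq_sym => /andP[/andP[/negbTE //]].
Qed.

Let sD : sorted (adj X Y nb) D.
Proof. by case/andP: uc => /=; rewrite !rcons_path => /andP[_ /andP[]]. Qed.

Let ybD : yb \in D. Proof. by rewrite /D inE mem_rcons mem_head orbT. Qed.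

Let yaP : ya \in Y /\ x \in nb ya.
Proof. by case/andP: uc => /= /andP[]; rewrite adjXY // => /andP[]. Qed.

Let ybP : yb \in Y /\ x \in nb yb.
Proof.
case/andP: uc => /= /andP[_]; rewrite rcons_path last_rcons => /andP[_ + _].
by rewrite adj_sym adjXY // => /andP[].
Qed.

(** [ya] and [yb] both lie in [Y], so they are not adjacent and [mid] is nonempty. *)
Let first_mid : exists u s, [/\ mid = u :: s, u \in X & u \in nb ya].
Proof.
have [yaY _] := yaP; have [ybY _] := ybP.
have := sD; rewrite /D; case: mid => [|u s] /=; rewrite adjYX // => /andP[/andP[uX un] _].
  by move: (disjointFr dXY uX); rewrite ybY.
by exists u, s.
Qed.

Let last_mid : exists s u, [/\ mid = rcons s u, u \in X & u \in nb yb].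
Proof.
have [yaY _] := yaP; have [ybY _] := ybP.
have := sD; rewrite /D; case/lastP: mid => [|s u] /=.
  rewrite andbT adjYX // => /andP[uX _].
  by move: (disjointFr dXY uX); rewrite ybY.
rewrite rcons_path last_rcons adj_sym adjYX // => /andP[_ /andP[uX un]].
by exists s, u.
Qed.

Let X'X : X' \subset X. Proof. exact: subsetDl. Qed.

Let Y'Y : Y' \subset Y.
Proof. by rewrite subUset sub1set subsetDl andbT; case: yaP. Qed.

Let neqD v w : v \in D -> w \notin D -> v != w.
Proof. by move=> vD; apply: contraNneq => <-. Qed.

(** Two of the at most three neighbors of [y] are its predecessor [u] and successor [v] in [D]. *)
Let card_nb_mid y : y \in mid -> y \in Y -> #|nb y :&: X'| <= 1.
Proof.
move=> ym yY; have [_ /(_ _ yY) dY _] := sc.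
have [s1 [s2 [u [v E]]]] : exists s1 s2 u v, D = rcons s1 u ++ y :: v :: s2.
  have := ym; rewrite /D => /splitPr[s1 s2].
  rewrite rcons_cat -cat_cons (lastI ya) /=.
  case: s2 => [|v s2].
    by exists (belast ya s1), [::], (last ya s1), yb.
  by exists (belast ya s1), (rcons s2 yb), (last ya s1), v.
have : [/\ u != v, u \in nb y :&: X & v \in nb y :&: X].
  have := sD; rewrite E sorted_glue /= adj_sym !adjYX // !inE.
  move=> /and4P[_ /andP[-> ->] /andP[-> ->] _]; split=> //.
  have := uD; rewrite E cat_uniq => /and3P[_ /hasPn/(_ v) + _].
  by rewrite !inE eqxx orbT mem_rcons inE eq_sym => /(_ isT); rewrite negb_or => /andP[].
case=> uv uN vN.
have uD' : u \in D by rewrite E mem_cat mem_rcons mem_head.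
have vD : v \in D by rewrite E mem_cat !inE eqxx !orbT.
have sub : nb y :&: X' \subset (nb y :&: X) :\ u :\ v.
  apply/subsetP=> w; rewrite !inE => /and3P[-> + ->] => wD.
  by rewrite !(eq_sym w) !neqD // !inE.
have := subset_leq_card sub; move/leq_trans; apply.
move: dY; rewrite (cardsD1 u) uN (cardsD1 v (_ :\ u)) !inE eq_sym uv.
by move: vN; rewrite !inE => -> /=; rewrite !add1n !ltnS.
Qed.

Let card_nb_end y u : y \in Y -> u \in D -> u \in X -> u \in nb y -> #|nb y :&: X'| <= 2.
Proof.
move=> yY uD' uX un; have [_ /(_ _ yY) dY _] := sc.
have sub : nb y :&: X' \subset (nb y :&: X) :\ u.
  apply/subsetP=> w; rewrite !inE => /and3P[-> + ->] => wD.
  by rewrite (eq_sym w) neqD // !inE.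
have := subset_leq_card sub; move/leq_trans; apply.
by move: dY; rewrite (cardsD1 u) !inE uX un.
Qed.

Let card_nb_ya : #|nb ya :&: X'| <= 2.
Proof.
have [u [s [E uX un]]] := first_mid.
by apply: (@card_nb_end _ u); [case: yaP | rewrite /D E !inE eqxx orbT | |].
Qed.

Let card_nb_yb : #|nb yb :&: X'| <= 2.
Proof.
have [s [u [E uX un]]] := last_mid.
apply: (@card_nb_end _ u) => //; first by case: ybP.
by rewrite /D E inE !mem_rcons !inE mem_rcons inE eqxx !orbT.
Qed.

Let xX' : x \in X'. Proof. by rewrite !inE xX andbT xD. Qed.

Let nb'_ya : nb' ya = nb ya :|: nb yb. Proof. by rewrite /nb' /merge_nb eqxx. Qed.

Let nb'_out y : y != ya -> nb' y = nb y.
Proof. by rewrite /nb' /merge_nb => /negbTE->. Qed.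

(** The merged vertex has at most [2 + 2 - 1] neighbors, as [x] is common to both ends. For a vertex
    of [X'] adjacent to [yb] but not to [ya], the merged vertex takes the place of the deleted
    [yb]. *)
Lemma cycle_subcubic : subcubic X' Y' nb'.
Proof.
have [_ dY dX] := sc; have [yaY xa] := yaP; have [ybY xb] := ybP.
split.
- by apply: disjointWl X'X _; apply: disjointWr Y'Y _.
- move=> y yY'; have [->|y_ya] := eqVneq y ya.
    rewrite nb'_ya setIUl cardsU leq_subLR.
    have x_in : 0 < #|nb ya :&: X' :&: (nb yb :&: X')|.
      by apply/card_gt0P; exists x; rewrite !inE xa xb xX xD.
    by apply: leq_trans (leq_add card_nb_ya card_nb_yb) _; rewrite (leq_add2r 3 1).
  rewrite nb'_out //; apply: leq_trans (dY y (subsetP Y'Y _ yY')).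
  exact/subset_leq_card/setIS/X'X.
- move=> v /(subsetP X'X)/dX; apply: leq_trans.
  have [va|va] := boolP (v \in nb ya).
    apply/subset_leq_card/subsetP=> y; rewrite inE => /andP[yY' vy].
    rewrite inE (subsetP Y'Y _ yY') /=; have [->//|y_ya] := eqVneq y ya.
    by rewrite nb'_out in vy.
  have [vb|vb] := boolP (v \in nb yb).
    rewrite [leqRHS](cardsD1 yb) [leqLHS](cardsD1 ya) [yb \in _]inE ybY vb.
    apply: leq_add; first exact: leq_b1.
    apply/subset_leq_card/subsetP=> y; rewrite !inE => /and3P[y_ya].
    rewrite (negbTE y_ya) /= nb'_out // => /andP[yD ->] ->.
    by rewrite ?andbT; apply: contraNneq yD => ->; rewrite mem_rcons mem_head.
  apply/subset_leq_card/subsetP=> y; rewrite inE => /andP[yY' vy].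
  rewrite inE (subsetP Y'Y _ yY') /=; have [y_ya|y_ya] := eqVneq y ya.
    by move: vy; rewrite y_ya nb'_ya inE (negbTE va) (negbTE vb).
  by rewrite nb'_out in vy.
Qed.

(* If [ya] and [yb] both count for [S], then each of them has [x] and one other
   vertex of [S] as neighbors, so dropping [x] loses both of them. *)
Lemma cycle_Lam n S : S \subset X' -> n + #|Lam Y' nb' S| <= #|S| ->
  exists2 S2 : {set T}, S2 \subset X & n + #|Lam Y nb S2| <= #|S2|.
Proof.
move=> sS bS; have [yaY xa] := yaP; have [ybY xb] := ybP.
(* A vertex of [Y] in [mid] has at most one neighbor left in [X'], so only [ya] and [yb] can be new
   in [Lam]. *)
have sLam S1 y : S1 \subset S -> y \in Lam Y nb S1 ->
      [|| y == ya, y == yb | y \in Lam Y' nb' S :\ ya].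
  move=> s1; rewrite inE => /andP[yY y2].
  have [//|y_ya] := eqVneq y ya; have [//|y_yb] := eqVneq y yb.
  have [yD|yD] := boolP (y \in D).
    have ym : y \in mid.
      by move: yD; rewrite inE mem_rcons inE (negbTE y_ya) (negbTE y_yb).
    have := card_nb_mid ym yY; rewrite leqNgt => /negP[].
    by apply: leq_trans y2 _; apply/subset_leq_card/setIS/(subset_trans s1).
  rewrite /= !inE nb'_out // y_ya yY andbT; move: yD => /= ->; rewrite orbT /=.
  by apply: leq_trans y2 _; apply/subset_leq_card/setIS.
have Lya y : (y == ya) || (y == yb) -> y \in Lam Y nb S -> ya \in Lam Y' nb' S.
  move=> y_ab; rewrite !inE nb'_ya eqxx /= => /andP[_ y2].
  apply: leq_trans y2 _; apply/subset_leq_card/setSI.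
  by case/orP: y_ab => /eqP->; rewrite ?subsetUl ?subsetUr.
have [aL|aL] := boolP (ya \in Lam Y nb S); last first.
  exists S; first exact: subset_trans X'X.
  apply: leq_trans bS; rewrite leq_add2l.
  (* If only [yb] counts, it is charged to the merged vertex, which then counts in the reduced
     graph. *)
  have [bL|bL] := boolP (yb \in Lam Y nb S).
    rewrite [leqRHS](cardsD1 ya) (Lya yb) ?eqxx ?orbT //.
    apply: leq_trans (_ : #|yb |: (Lam Y' nb' S :\ ya)| <= _); last first.
      by rewrite cardsU1; case: (_ \notin _).
    apply/subset_leq_card/subsetP=> y yL; have := sLam S y (subxx _) yL.
    by case/or3P=> [/eqP y_ya|/eqP->|yL']; rewrite ?setU11 ?setU1r //;
      move: aL; rewrite -y_ya yL.
  apply/subset_leq_card/subsetP=> y yL; have := sLam S y (subxx _) yL.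
  case/or3P=> [/eqP y_ya|/eqP y_yb|/setD1P[] //].
  - by move: aL; rewrite -y_ya yL.
  - by move: bL; rewrite -y_yb yL.
have [bL|bL] := boolP (yb \in Lam Y nb S); last first.
  exists S; first exact: subset_trans X'X.
  apply: leq_trans bS; rewrite leq_add2l.
  apply/subset_leq_card/subsetP=> y yL; have := sLam S y (subxx _) yL.
  case/or3P=> [/eqP->|/eqP y_yb|/setD1P[] //]; first by apply: (Lya ya); rewrite ?eqxx.
  by move: bL; rewrite -y_yb yL.
(* At most two neighbors in [X'] and at least two in [S] force the same set, which contains [x]. *)
have full y : #|nb y :&: X'| <= 2 -> x \in nb y -> y \in Lam Y nb S ->
    x \in S /\ y \notin Lam Y nb (S :\ x).
  move=> le2 xy; rewrite !inE => /andP[yY ge2].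
  have E : nb y :&: S = nb y :&: X'.
    by apply/eqP; rewrite eqEcard setIS // (leq_trans le2).
  have xS : x \in S by have: x \in nb y :&: S; [rewrite E inE xy xX' | case/setIP].
  split=> //; rewrite yY -ltnNge ltnS /=.
  have : #|nb y :&: S| <= 2 by rewrite E.
  by rewrite (cardsD1 x) inE xy xS setIDA.
have [xS aL'] := full ya card_nb_ya xa aL.
have [_ bL'] := full yb card_nb_yb xb bL.
exists (S :\ x).
  by apply: subset_trans (subsetDl _ _) _; apply: subset_trans X'X.
(* The loss of [x] from [S] is balanced by the merged vertex, which counted in [Lam Y' nb' S]. *)
move: bS; rewrite (cardsD1 x S) xS (cardsD1 ya) (Lya ya) ?eqxx // addnCA leq_add2l.
apply: leq_trans; rewrite leq_add2l.
apply/subset_leq_card/subsetP=> y yL; have := sLam _ y (subsetDl _ _) yL.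
by case/or3P=> [/eqP y_ya|/eqP y_yb|//];
  [move: aL'; rewrite -y_ya yL | move: bL'; rewrite -y_yb yL].
Qed.

Let X'D v : v \in X' -> v \notin D.
Proof. by rewrite inE => /andP[]; rewrite [v \in [set _ in _]]inE. Qed.

Let Y'D v : v != ya -> v \in Y' -> v \notin D /\ v \in Y.
Proof.
move=> v_ya; rewrite in_setU1 (negbTE v_ya) in_setD => /andP[].
by rewrite [v \in [set _ in _]]inE.
Qed.

Let adj'_adj u v : u != ya -> v != ya -> adj X' Y' nb' u v -> adj X Y nb u v.
Proof.
move=> u_ya v_ya; rewrite /adj => /orP[]/and3P[uX vY n].
  have [_ ->] := Y'D v_ya vY.
  by rewrite (subsetP X'X _ uX); rewrite nb'_out // in n; rewrite n.
have [_ ->] := Y'D u_ya vY.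
by rewrite (subsetP X'X _ uX); rewrite nb'_out // in n; rewrite n orbT.
Qed.

Let sorted_out s : ya \notin s -> sorted (adj X' Y' nb') s -> sorted (adj X Y nb) s.
Proof.
move=> ya_s; apply: (@sub_in_sorted _ (predC1 ya)).
  by move=> u v; apply: adj'_adj.
by apply/allP=> v vs; apply: contraNneq ya_s => <-.
Qed.

Let headX_sub p : headX X' p -> headX X p.
Proof. by case: p => //= z _ /(subsetP X'X). Qed.

Let all_sub p : all (mem (X' :|: Y')) p -> all (mem (X :|: Y)) p.
Proof. by apply: sub_all => v /=; apply/subsetP/setUSS. Qed.

Let good_out p : ya \notin p -> good X' Y' nb' p -> good X Y nb p.
Proof.
move=> ya_p /and4P[h1 h2 h3 h4].
by rewrite /good !headX_sub // sorted_out // all_sub.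
Qed.

Let all_D : all (mem (X :|: Y)) D.
Proof.
apply/allP=> v vD /=; have [yaY _] := yaP.
have: path (adj X Y nb) x D.
  by case/andP: uc => /= /andP[-> +] _; rewrite rcons_path => /andP[->].
elim: D x vD => //= w s IH z; rewrite inE => /predU1P[->|vs] /andP[zw ws].
  by move: zw; rewrite inE /adj => /orP[/and3P[_ -> _]|/and3P[-> _ _]//]; rewrite orbT.
exact: IH vs ws.
Qed.

(* [ya] has at most three remaining neighbors: [x] is adjacent to both ends of
   [D], and at most one other vertex is adjacent to each end; so any two of them
   can be linked through [D] in one of its two directions. *)
Let link a b : a != b -> adj X' Y' nb' a ya -> adj X' Y' nb' ya b ->
  (a \in nb ya) && (b \in nb yb) || (a \in nb yb) && (b \in nb ya).
Proof.
have [yaY xa] := yaP; have [ybY xb] := ybP.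
have dXY' : [disjoint X' & Y'] by case: cycle_subcubic.
have yaY' : ya \in Y' by rewrite setU11.
move=> ab; rewrite adj_sym !(adjYX _ _ dXY') // nb'_ya !inE.
have aux y : x \in nb y -> #|nb y :&: X'| <= 2 ->
    a != x -> b != x -> a \in X' -> b \in X' -> ~~ ((a \in nb y) && (b \in nb y)).
  move=> xy le2 ax bx aX bX; apply: contraL le2 => /andP[ay byy].
  rewrite -ltnNge (cardsD1 x) (cardsD1 a) (cardsD1 b) !inE.
  rewrite ax bx ay byy xy (eq_sym b a) ab /=.
  by move: xX' aX bX; rewrite !inE => -> -> ->; rewrite !add1n.
case/andP=> aX aN /andP[bX bN].
have [ax|ax] := eqVneq a x.
  by move: bN; rewrite ax xa xb orbC.
have [bx|bx] := eqVneq b x.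
  by move: aN; rewrite bx xa xb !andbT.
have aX' : a \in X' by rewrite !inE.
have bX' : b \in X' by rewrite !inE.
have := aux ya xa card_nb_ya ax bx aX' bX'; have := aux yb xb card_nb_yb ax bx aX' bX'.
by move: aN bN; do 4!case: (_ \in nb _).
Qed.

(** [E] is [D] or its reverse, according to which end of [D] is adjacent to [a]. *)
Let good_reroute q1 a b q2 (p := rcons q1 a ++ ya :: b :: q2) : uniq p ->
    good X' Y' nb' p ->
  exists2 E, perm_eq E D & good X Y nb (rcons q1 a ++ E ++ b :: q2).
Proof.
have [yaY xa] := yaP; have [ybY xb] := ybP.
have dXY' : [disjoint X' & Y'] by case: cycle_subcubic.
have yaY' : ya \in Y' by rewrite setU11.
move=> up /and4P[hp tp sp ap].
have := up; rewrite /p cat_uniq => /and3P[_ /hasPn hq /= /and3P[yb2 _ _]].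
have ya1 : ya \notin rcons q1 a by apply: hq; rewrite mem_head.
have ab : a != b.
  have := hq b; rewrite !inE eqxx orbT => /(_ isT).
  by rewrite /= mem_rcons inE negb_or eq_sym => /andP[].
move: sp; rewrite /p sorted_glue => /and3P[s1 a_ya /= /andP[ya_b s2]].
have := ap; rewrite /p all_cat => /andP[/all_sub a1 /= /and3P[_ bXY /all_sub a2]].
have aX : a \in X.
  by move: a_ya; rewrite adj_sym (adjYX _ _ dXY') // => /andP[/(subsetP X'X)].
have bX : b \in X.
  by move: ya_b; rewrite (adjYX _ _ dXY') // => /andP[/(subsetP X'X)].
(* Both directions are treated together: [c] and [d] are the first and last vertices of the inserted
   piece. *)
have glue c d s : c \in Y -> d \in Y -> a \in nb c -> b \in nb d ->
    perm_eq (c :: rcons s d) D -> sorted (adj X Y nb) (c :: rcons s d) ->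
    good X Y nb (rcons q1 a ++ (c :: rcons s d) ++ b :: q2).
  move=> cY dY ac bd pD ss; apply/and4P; split.
  - by move: hp; rewrite /p; case: (q1) => [|z q] //= /(subsetP X'X).
  - move: tp; rewrite /p !rev_cat !rev_cons !cat_rcons.
    by case: (rev q2) => [|z q] /= /(subsetP X'X).
  - have sbq : sorted (adj X Y nb) (b :: q2) by apply: sorted_out.
    rewrite sorted_glue sorted_out //= adjXY // cY ac /=.
    rewrite cat_path last_rcons; move: ss sbq => /= -> ->.
    by rewrite adjYX // bX bd.
  - rewrite !all_cat a1 (perm_all _ pD) all_D /= a2 andbT.
    by rewrite !inE bX.
case/orP: (link ab a_ya ya_b) => /andP[an bn].
  by exists D; rewrite // /D; apply: glue.
have revD : yb :: rcons (rev mid) ya = rev D by rewrite /D rev_cons rev_rcons.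
exists (yb :: rcons (rev mid) ya); first by rewrite revD perm_rev.
apply: glue => //; first by rewrite revD perm_rev.
by rewrite revD sorted_rev_sym //; apply: adj_sym.
Qed.

(** The only vertex of [D] left in the reduced graph is [ya], so [F] avoids [D]. *)
Let uniq_insert s F : uniq s -> {subset s <= D} -> uniq F ->
  {subset F <= X' :|: Y'} -> ya \notin F -> uniq (s ++ F).
Proof.
move=> us sD' uF sF ya_F; rewrite cat_uniq us uF andbT /=.
apply/hasPn=> v vF; apply: contra (sD' v) _.
have v_ya : v != ya by apply: contraNneq ya_F => <-.
by have := sF v vF; rewrite in_setU => /orP[/X'D //|/(Y'D v_ya)[] //].
Qed.

(* When [ya] is unused, [x] has at most one other available neighbor, so it ends
   its path. *)
Let end_x p : uniq p -> ya \notin p -> good X' Y' nb' p -> x \in p ->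
  exists2 q, perm_eq p (x :: q) & good X' Y' nb' (x :: q).
Proof.
have [yaY xa] := yaP; have [ybY xb] := ybP.
have dXY' : [disjoint X' & Y'] by case: cycle_subcubic.
move=> up ya_p gp xp; case/splitPr: xp up ya_p gp => q1 q2.
case: q2 => [|b q2].
  move=> _ _ gp; exists (rev q1); first by rewrite perm_sym -perm_rev rev_cons revK cats1.
  by rewrite -good_rev rev_cons revK -cats1.
case/lastP: q1 => [|q1 a]; first by exists (b :: q2).
rewrite cat_uniq => /and3P[_ /hasPn hq _].
rewrite mem_cat mem_rcons !inE !negb_or !(eq_sym ya).
move=> /and3P[/andP[aya _] _ /andP[bya _]] /and4P[_ _ + _].
rewrite sorted_glue /= => /and3P[_ + /andP[+ _]].
rewrite adj_sym !(adjXY _ _ dXY') //.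
rewrite !nb'_out // => /andP[aY' xna] /andP[bY' xnb].
have [aD aY] := Y'D aya aY'; have [bD bY] := Y'D bya bY'.
have ab : a != b.
  have := hq b; rewrite !inE eqxx orbT => /(_ isT).
  by rewrite /= mem_rcons inE negb_or eq_sym => /andP[].
(* An inner [x] would have four distinct neighbors: [ya], [yb] and its path neighbors [a] and
   [b]. *)
have [_ _ /(_ x xX)] := sc; rewrite leqNgt => /negP[].
rewrite (cardsD1 ya) (cardsD1 yb) (cardsD1 a) (cardsD1 b).
rewrite !inE yaY xa ybY xb aY xna bY xnb ya_yb aya bya (eq_sym b) ab.
by rewrite !(eq_sym _ yb) !(neqD ybD).
Qed.

(** This serves both cases of the expansion: [s] is all of [D] if [ya] is used, and [rcons mid yb]
    otherwise. Every vertex of [X] in [D] lies in [mid], so [mid] inside [s] suffices for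
    covering. *)
Let replace_path P p q R s :
    cover X' Y' nb' P -> perm_eq P (p :: R) -> ya \notin flatten R ->
    good X Y nb q -> perm_eq q (s ++ [seq v <- p | v != ya]) ->
    uniq s -> {subset s <= D} -> {subset mid <= s} ->
  exists2 Q, cover X Y nb Q & size Q = size P.
Proof.
move=> cP PR ya_R gq pq us sD' ms; have [yaY _] := yaP; have [ybY _] := ybP.
have cPR := cover_perm PR cP; have [/= /andP[_ gR] uF sF] := cPR.
exists (q :: R); last by rewrite (perm_size PR).
have mF v : v \in [seq v <- p | v != ya] ++ flatten R -> v \in flatten (p :: R).
  by rewrite /= !mem_cat mem_filter => /orP[/andP[_ ->]|->]; rewrite ?orbT.
split=> /=.
- rewrite gq; apply/allP=> r rR; apply: good_out; last exact: (allP gR).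
  by apply: contra ya_R => ya_r; apply/flattenP; exists r.
- rewrite (perm_uniq (_ : perm_eq _ (s ++ ([seq v <- p | v != ya] ++ flatten R)))).
    apply: uniq_insert => //.
    + move: uF; rewrite /= !cat_uniq => /and3P[up /hasPn pR uR].
      rewrite filter_uniq // uR andbT /=; apply/hasPn=> v /pR.
      by apply: contra; rewrite /= mem_filter => /andP[].
    + by move=> v /mF vF; apply: cover_mem cPR vF.
    + by rewrite mem_cat mem_filter eqxx.
  by rewrite catA perm_cat2r.
- move=> v vX; rewrite mem_cat (perm_mem pq) mem_cat mem_filter.
  have v_ya : v != ya by apply: contraTneq vX => ->; rewrite (disjointFl dXY yaY).
  have v_yb : v != yb by apply: contraTneq vX => ->; rewrite (disjointFl dXY ybY).
  have [vD|vD] := boolP (v \in D).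
    rewrite ms //; move: vD; rewrite inE mem_rcons inE.
    by rewrite (negbTE v_ya) (negbTE v_yb).
  have : v \in flatten (p :: R) by apply: sF; rewrite in_setD vX [_ \in [set _ in _]]inE vD.
  by rewrite /= mem_cat v_ya => /orP[->|->]; rewrite !orbT.
Qed.

Lemma cycle_cover P : cover X' Y' nb' P ->
  exists2 Q, cover X Y nb Q & size Q = size P.
Proof.
move=> cP; have [gP uP sP] := cP.
have mid_D : {subset mid <= D}.
  by move=> v vm; rewrite inE mem_rcons inE vm !orbT.
have pathP v : v \in flatten P -> exists p R, [/\ v \in p, perm_eq P (p :: R),
    good X' Y' nb' p & uniq (p ++ flatten R)].
  case/flattenP=> p pP vp; exists p, (rem p P); split=> //.
  - exact: perm_to_rem.
  - exact: (allP gP).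
  - by rewrite -/(flatten (p :: _)) -(perm_uniq (perm_flatten (perm_to_rem pP))).
have [/pathP[p [R [ya_p PR gp]]]|ya_P] := boolP (ya \in flatten P).
  rewrite cat_uniq => /and3P[up /hasPn pR _].
  have ya_R : ya \notin flatten R by apply: contraL ya_p => /pR.
  case/splitPr: ya_p up gp PR {pR} => q1 q2 up gp PR.
  (* [ya] is not in [X'], so it is an inner vertex of its good path. *)
  have [a [q1' E1]] : exists a q, q1 = rcons q a.
    case/lastP: q1 gp {up PR} => [/and4P[/= + _ _ _]|q a _]; last by exists a, q.
    by move/X'D; rewrite mem_head.
  have [b [q2' E2]] : exists b q, q2 = b :: q.
    case: q2 gp {up PR} => [/and4P[_ + _ _]|b q _]; last by exists b, q.
    by rewrite cats1 rev_rcons /= => /X'D; rewrite mem_head.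
  rewrite {}E1 {}E2 in up gp PR.
  have [E ED gE] := good_reroute up gp.
  apply: (@replace_path P _ _ R E cP PR ya_R gE).
  - rewrite perm_catCA perm_cat2l filter_cat /= eqxx /=.
    move: up; rewrite cat_uniq => /and3P[_ /hasPn hq /= /andP[ya2 _]].
    have ya1 : ya \notin rcons q1' a by apply: hq; rewrite mem_head.
    have fE s : ya \notin s -> [seq v <- s | v != ya] = s.
      by move=> ys; apply/all_filterP/allP=> v vs; apply: contraNneq ys => <-.
    by have := fE _ ya2; rewrite /= => ->; rewrite fE.
  - by rewrite (perm_uniq ED).
  - by move=> v; rewrite (perm_mem ED).
  - by move=> v /mid_D; rewrite (perm_mem ED).
have [p [R [xp PR gp]]] := pathP x (sP x xX').
rewrite cat_uniq => /and3P[up _ _].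
have ya_pR : ya \notin flatten (p :: R) by rewrite -(perm_mem (perm_flatten PR)).
move: ya_pR; rewrite /= mem_cat negb_or => /andP[ya_p ya_R].
have [q pq gq] := end_x up ya_p gp xp.
have ya_q : ya \notin x :: q by rewrite -(perm_mem pq).
have [u [s [mE uX un]]] := first_mid.
have [_ xb] := ybP; have [ybY _] := ybP.
(* [ya] is left out, since the prolonged path must end in [X]; it ends at the first vertex of
   [mid]. *)
apply: (@replace_path P p (rcons mid yb ++ x :: q) R (rcons mid yb)) => //.
- have /and4P[_ hq sq aq] := good_out ya_q gq.
  apply/and4P; split.
  + by rewrite mE /= uX.
  + by move: hq; rewrite rev_cat rev_cons; case: (rev q) => [|z w].
  + rewrite sorted_glue sq andbT; apply/andP; split.
      by have := sD; rewrite /D /= => /path_sorted.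
    by rewrite adj_sym adjXY // ybY.
  + by rewrite all_cat aq andbT; have := all_D; rewrite /D /= => /andP[].
- rewrite perm_cat2l; apply: perm_trans (_ : perm_eq p _).
    by rewrite perm_sym.
  rewrite (_ : [seq v <- p | v != ya] = p) //.
  by apply/all_filterP/allP=> v vs; apply: contraNneq ya_p => <-.
- by have := uD; rewrite /D /= => /andP[].
- by move=> v vm; rewrite /D inE vm orbT.
- by move=> v vm; rewrite mem_rcons inE vm orbT.
Qed.

Lemma cycle_proper : #|X'| < #|X|.
Proof.
have [u [s [mE uX _]]] := first_mid; apply/proper_card/properP; split=> //.
exists u => //; rewrite in_setD [_ \in [set _ in _]]inE negb_and negbK.
by rewrite /D mE !inE eqxx !orbT.
Qed.

Lemma solvable_cycle : solvable X' Y' nb' -> solvable X Y nb.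
Proof.
case=> P [S [/cycle_cover[Q cQ <-] sS /(cycle_Lam sS)[S2 sS2 bS2]]].
by exists Q, S2.
Qed.

End CycleStep.

(** * Existence of the cycle, and the induction *)

(** In the graph induced on [K :|: E], the effective vertices and the vertices of [X] with two
    effective neighbors, every vertex has two neighbors. *)
Lemma exists_cycle X Y nb :
    [disjoint X & Y] -> X != set0 ->
    {in X, forall x, eff X Y nb x != set0} ->
    (forall y a b, a != b -> nb y :&: X = [set a; b] -> eff X Y nb a != [set y]) ->
    (forall y a b, a != b -> a \in X -> b \in X ->
      eff X Y nb a = [set y] -> eff X Y nb b != [set y]) ->
  exists x c, [/\ x \in X, ucycle (adj X Y nb) (x :: c) & 1 < size c].
Proof.
move=> dXY /set0Pn[x0 x0X] no_iso no_pend no_cherry.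
pose K := [set x in X | 1 < #|eff X Y nb x|].
pose E := [set y in Y | 1 < #|nb y :&: X|].
have leaf y x : y \in E -> x \in nb y -> x \in X -> x \notin K -> eff X Y nb x = [set y].
  rewrite !inE => /andP[yY y2] xy xX; rewrite xX /= -leqNgt => le1.
  by apply/esym/eqP; rewrite eqEcard sub1set cards1 le1 !inE yY xy y2.
(* By [no_cherry] at most one neighbor [a] of [y] lies outside [K]; by [no_pend] at least two others
   then remain. *)
have E_K y : y \in E -> 1 < #|nb y :&: K|.
  move=> yE; have := yE; rewrite inE => /andP[yY y2].
  have [sK|/subsetPn[a]] := boolP (nb y :&: X \subset K).
    apply: leq_trans y2 _; apply/subset_leq_card/subsetP=> v vyX.
    by rewrite inE (subsetP sK _ vyX) andbT; case/setIP: vyX.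
  rewrite inE => /andP[ay aX] aK; have ea := leaf y a yE ay aX aK.
  have sub : (nb y :&: X) :\ a \subset nb y :&: K.
    apply/subsetP=> b; rewrite !in_setD1 !in_setI => /and3P[ba by' bX].
    rewrite by' /=; apply/negPn/negP=> bK; have := leaf y b yE by' bX bK.
    by apply/eqP; apply: (no_cherry y a b); rewrite // eq_sym.
  apply: leq_trans (subset_leq_card sub); move: y2.
  rewrite (cardsD1 a) inE ay aX add1n ltnS leq_eqVlt eq_sym => /orP[/cards1P[b Eb]|//].
  have ba : b != a by have: b \in [set b]; [rewrite inE | rewrite -Eb => /setD1P[]].
  have /negP[] : eff X Y nb a != [set y]; last by rewrite ea.
  apply: (no_pend y a b); first by rewrite eq_sym.
  by rewrite -Eb setD1K // inE ay.
have [c uc c3] : exists2 c : seq T, ucycle (adj X Y nb) c & 2 < size c.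
  apply: (@exists_ucycle T (adj X Y nb) (K :|: E)).
  - exact: adj_sym.
  - exact: adj_irr.
  - have /set0Pn[y] := no_iso x0 x0X; rewrite inE => /and3P[yY _ y2].
    by apply/set0Pn; exists y; rewrite !inE yY y2 orbT.
  - move=> v /setUP[vK|vE].
      have := vK; rewrite inE => /andP[vX /card_gt1P[a [b [ae be ab]]]].
      exists a, b; move: ae be; rewrite !inE => /and3P[aY va a2] /and3P[bY vb b2].
      by rewrite ab aY a2 bY b2 !orbT !adjXY // aY bY va vb.
    have /card_gt1P[a [b [/setIP[ay aK] /setIP[by' bK] ab]]] := E_K v vE.
    move: vE; rewrite inE => /andP[vY _]; exists a, b.
    rewrite !in_setU aK bK !adjYX // ay by' !andbT.
    by move: aK bK; rewrite !inE => /andP[-> _] /andP[-> _].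
(* One of the first two vertices is in [X], because they are adjacent; the cycle is then rotated to
   start there. *)
have [x xc xX] : exists2 x, x \in c & x \in X.
  case: c uc c3 => [|v [|w c]] // /andP[/= /andP[+ _] _] _.
  rewrite /adj => /orP[]/and3P[h _ _]; first by exists v; rewrite ?mem_head.
  by exists w; rewrite // !inE eqxx orbT.
have [i c' E'] := rot_to xc.
exists x, c'; rewrite -E' rot_ucycle; split=> //.
by rewrite -(size_rot i) E' in c3.
Qed.

(** The induction on [#|X|] also generalizes [nb], which the contraction changes. *)
Lemma subcubic_solvable X Y nb : subcubic X Y nb -> solvable X Y nb.
Proof.
have [n] := ubnP #|X|; elim: n => // n IH in X Y nb *; rewrite ltnS => le_n sc.
have [dXY _ _] := sc.
have rec (X1 Y1 : {set T}) : X1 \proper X -> Y1 \subset Y -> solvable X1 Y1 nb.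
  move=> pX sY; apply: IH; first exact: leq_trans (proper_card pX) le_n.
  exact: subcubic_sub (proper_sub pX) sY sc.
have [->|X0] := eqVneq X set0.
  exists [::], set0; split=> //; first by split=> // x; rewrite inE.
  by rewrite (_ : Lam _ _ _ = set0) ?cards0 //; apply/setP=> y;
    rewrite !inE setI0 cards0 andbF.
have properD2 a b : a \in X -> X :\: [set a; b] \proper X.
  by move=> aX; apply/properP; split; [exact: subsetDl | exists a; rewrite ?inE ?eqxx].
have [/exists_inP[x xX /eqP ex]|no_iso] := boolP [exists x in X, eff X Y nb x == set0].
  by apply: (solvable_isolated dXY xX ex); apply: rec; rewrite ?properD1.
have [/existsP[y /existsP[a /existsP[b /and3P[ab /eqP nby /eqP ea]]]]|no_pend] :=
    boolP [exists y, exists a, exists b,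
      [&& a != b, nb y :&: X == [set a; b] & eff X Y nb a == [set y]]].
  apply: (solvable_pendant dXY ab nby ea); apply: rec; last exact: subsetDl.
  by apply: properD2; have: a \in nb y :&: X; [rewrite nby !inE eqxx | case/setIP].
have [/existsP[y /existsP[a /existsP[b /and5P[ab aX bX /eqP ea /eqP eb]]]]|no_cherry] :=
    boolP [exists y, exists a, exists b,
      [&& a != b, a \in X, b \in X, eff X Y nb a == [set y] & eff X Y nb b == [set y]]].
  apply: (solvable_cherry dXY ab aX bX ea eb); apply: rec; last exact: subsetDl.
  exact: properD2.
have [x [c [xX uc c2]]] : exists x c,
    [/\ x \in X, ucycle (adj X Y nb) (x :: c) & 1 < size c].
  apply: exists_cycle => //.
  - by move=> x xX; apply: contra no_iso => ex; apply/exists_inP; exists x.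
  - move=> y a b ab /eqP nby; apply: contra no_pend => ea.
    by apply/existsP; exists y; apply/existsP; exists a; apply/existsP; exists b;
      apply/and3P.
  - move=> y a b ab aX bX /eqP ea; apply: contra no_cherry => eb.
    by apply/existsP; exists y; apply/existsP; exists a; apply/existsP; exists b;
      apply/and5P.
case: c uc c2 => [|ya c] //; case/lastP: c => [|mid yb] // uc _.
apply: (solvable_cycle sc xX uc); apply: IH; last exact: cycle_subcubic sc xX uc.
exact: leq_trans (cycle_proper sc xX uc) le_n.
Qed.

End TripleSystems.

(** * Transfer to a bigraph given by its edge relation *)

Theorem theorem5 (T : finType) (e : rel T) (X Y : {set T}) :
  bigraph e X Y ->
  max_degree e <= 3 ->
  exists P : seq (seq T),
    path_cover e X P /\ ((size P)%:Z <= def_Lambda e X Y)%R.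
Proof.
move=> [[es ei] [_ dXY eXY]] md.
have deg v : #|neighbors e v| <= 3.
  by apply: leq_trans md; apply: (leq_bigmax v).
have sc : subcubic X Y (neighbors e).
  split=> // [y _|x _].
    by apply: leq_trans (deg y); apply/subset_leq_card/subsetIl.
  apply: leq_trans (deg x); apply/subset_leq_card/subsetP=> y.
  by rewrite !inE es => /andP[].
have [P [S [[gP uP sP] sS bS]]] := subcubic_solvable sc.
exists P; split; last first.
  (* The deficiency of the set [S] found above already bounds the number of paths. *)
  apply: Order.POrderTheory.le_trans (def_Lambda_ge e Y sS).
  by rewrite /def_Lambda_at Num.Theory.lerBrDr -PoszD lez_nat.
have sub_e u v : adj X Y (neighbors e) u v -> e u v.
  by rewrite /adj !inE => /orP[]/and3P[_ _]; rewrite // es.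
have pP : pairwise (fun p q : seq T => [disjoint p & q]) P /\ all uniq P.
  elim: P uP {gP sP bS} => //= p P IH; rewrite cat_uniq => /and3P[-> /hasPn pP /IH[-> ->]].
  split=> //; rewrite andbT; apply/allP=> q qP; rewrite disjoint_sym.
  apply/pred0P=> v /=; apply/negbTE/negP=> /andP[vq vp].
  have vP : v \in flatten P by apply/flattenP; exists q.
  by have := pP v vP; rewrite /= vp.
case: pP => dP /allP uniqP; split=> //.
  apply/allP=> p pP; have /and4P[hp _ sp _] := allP gP p pP.
  case: p {gP} pP hp sp => //= z s pP _ zs; rewrite -/(uniq (z :: s)) uniqP //.
  by rewrite andbT; apply: sub_path zs.
by move=> x /sP/flattenP[p pP xp]; exists p.
Qed.
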